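(* Let $\mathfrak X$ be a homogeneous tree of degree $q+1$ ($q\geq1$), let $k,\ell$ be integers with $2\leq k<\ell$, and let $d=\gcd(k,\ell)$. Then the snapshot $f_d$ of a wave $\{f_j\}_{j\in\mathbb Z}$ is determined by $f_0,f_k,f_\ell$: if two waves have the same snapshots at times $0,k,\ell$, then they have the same snapshot at time $d$. In particular, if $k$ and $\ell$ are relatively prime, then a wave is uniquely determined by its snapshots $f_0,f_k,f_\ell$.
   Context: $\mathfrak X$ is a tree in which every vertex has exactly $q+1$ edges; $\mathcal F(\mathfrak X)$ is the space of complex-valued functions on its vertices; $\mu_1f(v)=\frac{1}{q+1}\sum_{w\text{ adjacent to }v}f(w)$. A wave is a family $\{f_j\}_{j\in\mathbb Z}$ in $\mathcal F(\mathfrak X)$ with $\mu_1f_j=\frac{f_{j+1}+f_{j-1}}{2}$ for all $j\in\mathbb Z$; $f_j$ is its snapshot at time $j$. *)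

(* Defs.v *)
From HB Require Import structures.
From mathcomp Require Import all_boot all_order all_algebra.
From mathcomp Require Import boolp classical_sets functions cardinality fsbigop.
From mathcomp Require Import reals complex.

Set Implicit Arguments.
Unset Strict Implicit.
Unset Printing Implicit Defensive.

Import Order.TTheory GRing.Theory Num.Theory.

Local Open Scope classical_set_scope.
Local Open Scope card_scope.
Local Open Scope ring_scope.

Section HomogeneousTree.
Variables (V : choiceType) (adj : rel V).

Definition neighbors (v : V) : set V := [set w | adj v w].

Definition connected_graph : Prop :=
  forall v w : V, exists2 p : seq V, path adj v p & last v p = w.

(* The bound on the length is needed because, [adj] being symmetric, an edge
   [v, w] is itself a [ucycle] of length 2. *)
Definition acyclic_graph : Prop :=
  forall c : seq V, (2 < size c)%N -> ~ ucycle adj c.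

Definition is_tree : Prop :=
  [/\ inhabited V, symmetric adj, irreflexive adj,
      connected_graph & acyclic_graph].

Definition homogeneous_tree (q : nat) : Prop :=
  is_tree /\ forall v : V, neighbors v #= `I_q.+1.

End HomogeneousTree.

(* The sum is over the set [neighbors adj v], which is finite (with [q.+1]
   elements) as soon as [homogeneous_tree adj q] holds. *)
Definition mu1 (R : realType) (V : choiceType) (adj : rel V) (q : nat)
    (f : V -> R[i]) (v : V) : R[i] :=
  q.+1%:R^-1 * \sum_(w \in neighbors adj v) f w.

Definition is_wave (R : realType) (V : choiceType) (adj : rel V) (q : nat)
    (f : int -> V -> R[i]) : Prop :=
  forall (j : int) (v : V),
    mu1 adj q (f j) v = (f (j + 1) v + f (j - 1) v) / 2.

(* Main.v *)
Require Import Defs.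
From mathcomp Require Import all_boot all_order all_algebra.
From mathcomp Require Import boolp cardinality functions fsbigop ring.
From mathcomp Require Import reals complex.

Import Order.TTheory GRing.Theory Num.Theory.
Local Open Scope ring_scope.

(** A difference [h] of two waves is a wave, and vanishing at a time [a] makes it
    odd about [a], since both sides solve the same second order recurrence.
    Vanishing at [0] and [m] thus makes [h] periodic of period [2m]. The set of
    half-periods is a subgroup of the integers containing [k] and [l], hence
    [d = gcd(k, l)]. As [k/d] or [l/d] is odd, [h_d] equals [h_k] or [h_l].
    The tree enters only through the finiteness of the neighborhoods, which
    makes [mu1] additive. *)

Section SecondOrderRecurrence.
Set Implicit Arguments.
Variables (M : zmodType) (A : M -> M) (h : int -> M).
Hypothesis AB : {morph A : x y / x - y}.
Hypothesis hA : forall j, h (j + 1) + h (j - 1) = A (h j).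

Lemma recurrence_odd a : h a = 0 -> forall n, h (a - n) = - h (a + n).
Proof.
move=> ha; have A0 : A 0 = 0 by rewrite -[X in A X](subrr 0) AB subrr.
have AN x : A (- x) = - A x by rewrite -sub0r AB A0 sub0r.
(* The recurrence has order two, so the induction carries two consecutive values; for [n = 0] the
   second one is the recurrence at [a], whose right side is [A 0 = 0]. *)
have odd_nat (n : nat) :
    h (a - n%:Z) = - h (a + n%:Z) /\ h (a - n.+1%:Z) = - h (a + n.+1%:Z).
  elim: n => [|n [IHn IHn1]].
    rewrite subr0 ha oppr0; split=> //; apply/eqP.
    by rewrite -addr_eq0 addrC hA ha A0.
  split=> //.
  (* The right sides at these two mirror times are opposite; cancelling the inner terms, opposite by
     induction, leaves the outer ones. *)
  have := hA (a + n.+1%:Z); have := hA (a - n.+1%:Z).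
  have -> : a - n.+1%:Z + 1 = a - n%:Z by rewrite intS; ring.
  have -> : a - n.+1%:Z - 1 = a - n.+2%:Z by rewrite !intS; ring.
  have -> : a + n.+1%:Z + 1 = a + n.+2%:Z by rewrite !intS; ring.
  have -> : a + n.+1%:Z - 1 = a + n%:Z by rewrite intS; ring.
  rewrite IHn1 AN IHn => hm hp; move: hm.
  by rewrite -hp opprD [RHS]addrC => /addrI.
case=> n; first by case: (odd_nat n).
by rewrite NegzE opprK; case: (odd_nat n) => _ ->; rewrite opprK.
Qed.

(** The reflections about [0] and [m] compose to the translation by [2m], and the two signs
    cancel. *)
Lemma recurrence_periodic m :
  h 0 = 0 -> h m = 0 -> forall j, h (j + m *+ 2) = h j.
Proof.
move=> h0 hm j; have := recurrence_odd hm (- (j + m)).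
have -> : m - - (j + m) = j + m *+ 2 by ring.
have -> : m - (j + m) = 0 - j by ring.
by rewrite (recurrence_odd h0) opprK add0r.
Qed.

End SecondOrderRecurrence.

Section HalfPeriods.
Set Implicit Arguments.
Variables (M : Type) (h : int -> M).

(** Halves of periods are recorded so that Bezout applies directly to the times at which [h]
    vanishes. *)
Definition half_period m := forall j, h (j + m *+ 2) = h j.

Lemma half_periodD m n : half_period m -> half_period n -> half_period (m + n).
Proof. by move=> hm hn j; rewrite mulrnDl addrA hn hm. Qed.

Lemma half_periodN m : half_period m -> half_period (- m).
Proof. by move=> hm j; rewrite -[LHS]hm mulNrn subrK. Qed.

Lemma half_periodM c m : half_period m -> half_period (c * m).
Proof.
move=> hm; have hnat (n : nat) : half_period (n%:Z * m).
  elim: n => [|n IHn] => [j|]; first by rewrite mul0r mul0rn addr0.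
  by rewrite intS mulrDl mul1r; apply: half_periodD.
case: c => n; first exact: hnat.
by rewrite NegzE mulNr; apply/half_periodN/hnat.
Qed.

Lemma half_period_gcdz m n :
  half_period m -> half_period n -> half_period (gcdz m n).
Proof.
move=> hm hn; case: (Bezoutz m n) => u [v <-].
by apply: half_periodD; apply: half_periodM.
Qed.

(** Here [(2c + 1) d = d + 2 (c d)], and [c d] is again a half-period. *)
Lemma half_period_odd d c : half_period d -> h ((c *+ 2 + 1) * d) = h d.
Proof. by move=> /(half_periodM c) hd; rewrite -[RHS]hd; congr h; ring. Qed.

End HalfPeriods.

Lemma int_half (c : int) : exists t, c = t *+ 2 \/ c = t *+ 2 + 1.
Proof.
exists (c %/ 2)%Z; have := divz_eq c 2.
have : (c %% 2)%Z < 2 by apply: ltz_pmod.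
have : 0 <= (c %% 2)%Z by apply: modz_ge0.
case: (c %% 2)%Z => [[|[|n]]|n] // _ _ cE; [left | right];
  by rewrite {1}cE mulr_natr ?addr0.
Qed.

(** If both cofactors were even, twice the gcd would divide [m] and [n], hence the gcd itself, which
    is nonzero because [m] is. *)
Lemma odd_cofactor_gcdz (m n : int) : m != 0 ->
  exists c, m = (c *+ 2 + 1) * gcdz m n \/ n = (c *+ 2 + 1) * gcdz m n.
Proof.
move=> m0; have d0 : gcdz m n != 0 by rewrite gcdz_eq0 negb_and m0.
have /dvdzP[a ma] := dvdz_gcdl m n; have /dvdzP[b nb] := dvdz_gcdr m n.
case: (int_half a) => s [] sE; last by exists s; left; rewrite -sE.
case: (int_half b) => t [] tE; last by exists t; right; rewrite -tE.
have : (2 * gcdz m n %| gcdz m n)%Z.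
  rewrite dvdz_gcd; apply/andP; split; apply/dvdzP.
    by exists s; rewrite {1}ma sE; ring.
  by exists t; rewrite {1}nb tE; ring.
(* Cancelling the gcd leaves [1 = c * 2], so [2] would divide [1]. *)
case/dvdzP=> c /eqP; rewrite mulrA -subr_eq0 -{1}[gcdz m n]mul1r -mulrBl.
rewrite mulf_eq0 (negPf d0) orbF subr_eq0 => /eqP c2.
by have := dvdz_mull c (dvdzz 2); rewrite -c2.
Qed.

Section Waves.
Set Implicit Arguments.
Unset Strict Implicit.
Variables (R : realType) (V : choiceType) (adj : rel V) (q : nat).
Hypothesis adj_fin : forall v, finite_set (neighbors adj v).

(** A sum over a set takes the default value [0] when its summand has infinite support there, which
    would break additivity; finite neighborhoods make it an ordinary finite sum. *)
Lemma mu1B (f g : V -> R[i]) v :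
  mu1 adj q (f - g) v = mu1 adj q f v - mu1 adj q g v.
Proof. by rewrite /mu1 -mulrBr !fsbig_finite // -sumrB. Qed.

(** This puts a wave in the form of the abstract recurrence, with values in the group of functions
    on [V] and [A] equal to twice [mu1]. *)
Lemma wave_recurrence (f : int -> V -> R[i]) : is_wave adj q f ->
  forall j, f (j + 1) + f (j - 1) = (fun v => 2 * mu1 adj q (f j) v).
Proof.
by move=> fw j; apply/funext => v; rewrite fw mulrC divfK // pnatr_eq0.
Qed.

(** The half-period is kept in the conclusion because the coprime case uses it to pass from times
    [0] and [1] to all times. *)
Lemma wave_gcdz (k l : int) (f g : int -> V -> R[i]) : k != 0 ->
  is_wave adj q f -> is_wave adj q g ->
  f 0 = g 0 -> f k = g k -> f l = g l ->
  f (gcdz k l) = g (gcdz k l) /\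
  half_period (fun j => f j - g j) (gcdz k l).
Proof.
move=> k0 fw gw fg0 fgk fgl; pose h j := f j - g j.
pose A (u : V -> R[i]) : V -> R[i] := fun v => 2 * mu1 adj q u v.
have AB : {morph A : x y / x - y}.
  by move=> x y; apply/funext => v; rewrite /A mu1B mulrBr.
have hA j : h (j + 1) + h (j - 1) = A (h j).
  rewrite /h AB -[A (f j)]wave_recurrence // -[A (g j)]wave_recurrence //.
  by rewrite addrACA opprD.
have h0 : h 0 = 0 by rewrite /h fg0 subrr.
have hk : h k = 0 by rewrite /h fgk subrr.
have hl : h l = 0 by rewrite /h fgl subrr.
have hd : half_period h (gcdz k l).
  apply: half_period_gcdz; first exact: recurrence_periodic AB hA _ h0 hk.
  exact: recurrence_periodic AB hA _ h0 hl.
split=> //; apply/eqP; rewrite -subr_eq0; apply/eqP.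
have [c kl] := odd_cofactor_gcdz k l k0.
rewrite -[LHS]/(h _) -(half_period_odd c hd).
by case: kl => <-.
Qed.

(** With gcd [1] the difference of the waves has period [2], so its zero at time [0] settles the
    even times and its zero at time [1] the odd ones. *)
Lemma wave_coprimez (k l : int) (f g : int -> V -> R[i]) : k != 0 ->
  coprimez k l -> is_wave adj q f -> is_wave adj q g ->
  f 0 = g 0 -> f k = g k -> f l = g l -> f = g.
Proof.
move=> k0 /eqP kl fw gw fg0 fgk fgl.
have [] := wave_gcdz k0 fw gw fg0 fgk fgl; rewrite kl => fg1 h1.
apply/funext => j; apply/eqP; rewrite -subr_eq0.
have [t tE] := int_half j; have /= := half_periodM t h1.
rewrite /half_period mulr1 => ht.
case: tE => ->; first by have := ht 0; rewrite add0r fg0 subrr => ->.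
by have := ht 1; rewrite fg1 subrr [1 + _]addrC => ->.
Qed.

End Waves.

Theorem theorem5p2 (R : realType) (V : choiceType) (adj : rel V) (q : nat)
    (hq : (1 <= q)%N) (hX : homogeneous_tree adj q)
    (k l : int) (hk : 2 <= k) (hkl : k < l) :
  (forall f g : int -> V -> R[i],
     is_wave adj q f -> is_wave adj q g ->
     f 0 = g 0 -> f k = g k -> f l = g l ->
     f (gcdz k l) = g (gcdz k l)) /\
  (coprimez k l ->
   forall f g : int -> V -> R[i],
     is_wave adj q f -> is_wave adj q g ->
     f 0 = g 0 -> f k = g k -> f l = g l ->
     f = g).
Proof.
have k0 : k != 0 by apply: lt0r_neq0; apply: lt_le_trans hk.
have adj_fin v : finite_set (neighbors adj v) by exists q.+1; apply: hX.2.
split=> [f g fw gw fg0 fgk fgl | kl f g].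
  by have [] := wave_gcdz adj_fin k0 fw gw fg0 fgk fgl.
exact: (wave_coprimez adj_fin k0 kl).
Qed.
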